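(* Let $p\in(1,\infty)$. Then $W^{1,p}\cap\Lambda_1\subsetneqq\overline{W^{1,p}\cap\Lambda_1}^{\Lambda_1}\subsetneqq\Lambda_1$, where the closure is taken in the norm of $\Lambda_1$.
   Context: $\Lambda_1$: bounded continuous $f$ on $\mathbb R^n$ with $\|f\|_{\Lambda_1}:=\|f\|_{L^\infty}+\sup_{x\in\mathbb R^n,y\in(0,1]}\sup_{|h|=y}|f(x+h)-2f(x)+f(x-h)|/y<\infty$. $W^{1,p}$ is the usual Sobolev space on $\mathbb R^n$. *)

(* Defs.v *)
From HB Require Import structures.
From mathcomp Require Import all_boot all_order all_algebra.
From mathcomp Require Import all_classical all_reals all_analysis.
Set Implicit Arguments. Unset Strict Implicit. Unset Printing Implicit Defensive.
Import Order.TTheory GRing.Theory Num.Theory.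
Import numFieldNormedType.Exports.
Local Open Scope classical_set_scope.
Local Open Scope ring_scope.

Section Defs.
Context {R : realType} {n : nat}.

Definition eucl (h : 'rV[R]_n) : R := Num.sqrt (\sum_(i < n) h 0 i ^+ 2).

Definition ev (i : 'I_n) : 'rV[R]_n := delta_mx 0 i.

Definition Rn := g_sigma_algebraType (@open 'rV[R]_n).

Definition box (a b : 'rV[R]_n) : set 'rV[R]_n :=
  [set x | forall i, a 0 i <= x 0 i <= b 0 i].
Definition vol (a b : 'rV[R]_n) : R := \prod_(i < n) Num.max 0 (b 0 i - a 0 i).
Definition lebn (A : set Rn) : \bar R :=
  ereal_inf [set (\sum_(0 <= k <oo) (vol (ab.1 k) (ab.2 k))%:E)%E
            | ab in [set ab : (nat -> 'rV[R]_n) * (nat -> 'rV[R]_n) |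
                     A `<=` \bigcup_k box (ab.1 k) (ab.2 k)]].

Definition Lp (p : R) (f : Rn -> R) : Prop :=
  measurable_fun setT f /\
  (\int[lebn]_x (`|f x| `^ p)%:E < +oo)%E.

Fixpoint iterD (s : seq 'I_n) (f : 'rV[R]_n -> R) : 'rV[R]_n -> R :=
  match s with
  | [::] => f
  | i :: s' => 'D_(ev i) (iterD s' f)
  end.

Definition test_fun (phi : 'rV[R]_n -> R) : Prop :=
  (forall s x, differentiable (iterD s phi) x) /\
  compact (closure [set x | phi x != 0]).

Definition weak_partial (i : 'I_n) (f g : 'rV[R]_n -> R) : Prop :=
  forall phi, test_fun phi ->
    (\int[lebn]_x (f x * 'D_(ev i) phi x)%:E
     = - \int[lebn]_x (g x * phi x)%:E)%E.

Definition W1p (p : R) (f : 'rV[R]_n -> R) : Prop :=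
  Lp p f /\ forall i : 'I_n, exists g, Lp p g /\ weak_partial i f g.

Definition sup_norm (f : 'rV[R]_n -> R) : \bar R :=
  ereal_sup [set (`|f x|)%:E | x in [set: 'rV[R]_n]].
Definition zyg_seminorm (f : 'rV[R]_n -> R) : \bar R :=
  ereal_sup [set (`|f (xh.1 + xh.2) - 2 * f xh.1 + f (xh.1 - xh.2)| / eucl xh.2)%:E
            | xh in [set xh : 'rV[R]_n * 'rV[R]_n | 0 < eucl xh.2 <= 1]].
Definition Lambda1_norm (f : 'rV[R]_n -> R) : \bar R :=
  (sup_norm f + zyg_seminorm f)%E.

Definition Lambda1 : set ('rV[R]_n -> R) :=
  [set f | continuous f /\ (sup_norm f < +oo)%E /\ (Lambda1_norm f < +oo)%E].

Definition Lambda1_closure (S : set ('rV[R]_n -> R)) : set ('rV[R]_n -> R) :=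
  [set g | Lambda1 g /\ forall eps : R, 0 < eps ->
     exists f, S f /\ (Lambda1_norm (fun x => (f x - g x)%R) < eps%:E)%E].

End Defs.

(* Main.v *)
Require Import Defs.
From HB Require Import structures.
From mathcomp Require Import all_boot all_order all_algebra.
From mathcomp Require Import all_classical all_reals all_analysis.
From mathcomp Require Import measurable_realfun ring lra.
Set Implicit Arguments. Unset Strict Implicit. Unset Printing Implicit Defensive.
Import Order.TTheory GRing.Theory Num.Theory.
Import numFieldNormedType.Exports.
Local Open Scope classical_set_scope.
Local Open Scope ring_scope.

(** Both inclusions are strict because of decay at infinity. A function that is
    uniformly within 1/2 of the constant 1 is bounded below, hence not in L^p: so
    1 is not in the closure. For the first inclusion let
    h = prod_i (1 + x_i^2)^(-a) with a = 1/(8 p n). Then h is Lipschitz and so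
    slow to decay that g = h^2 is not in L^p, while f_e = (max (h - e) 0)^2 is C^1
    with compact support, hence in W^{1,p}; since f_e - g has sup norm and
    Lipschitz constant O(e), it tends to 0 in Lambda_1.

    The set function [lebn] is an outer measure for which half-spaces are
    Caratheodory measurable, hence a translation invariant Borel measure, and the
    weak derivatives of f_e come from dominated convergence of difference
    quotients of f_e * phi, each of which integrates to 0. *)

(** * Lebesgue measure *)

Section lebesgue_outer_measure.
Context {R : realType} {m : nat}.
Local Notation n := m.+1.
Local Notation V := 'rV[R]_n.

Lemma vol_ge0 (a b : V) : 0 <= vol a b.
Proof. by apply: prodr_ge0 => i _; rewrite le_max lexx. Qed.

(* Every set is measurable in [powV], so that [mu_ext box_hull] ranges over all
   countable covers and the library's outer measure theory applies to [lebn]. *)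
Definition powV := g_sigma_algebraType [set: set V].

(** One box at a time: the value is [+oo] on sets that no box contains, and [mu_ext] supplies the
    countable covers. *)
Definition box_hull (A : set powV) : \bar R :=
  ereal_inf [set (vol ab.1 ab.2)%:E | ab in [set ab : V * V | A `<=` box ab.1 ab.2]].

Lemma box_hull_ge0 A : (0 <= box_hull A)%E.
Proof. by apply: le_ereal_inf_tmp => _ [ab _ <-]; rewrite lee_fin vol_ge0. Qed.

Lemma box_hull_le A (a b : V) : A `<=` box a b -> (box_hull A <= (vol a b)%:E)%E.
Proof. by move=> Aab; apply: ereal_inf_lbound; exists (a, b). Qed.

(** The dimension is a successor, so the product has a factor; in dimension 0 it would be 1. *)
Lemma vol0 (a : V) : vol a a = 0.
Proof. by rewrite /vol big_ord_recl subrr maxxx mul0r. Qed.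

Lemma box_hull0 : box_hull set0 = 0%E.
Proof.
apply/eqP; rewrite eq_le box_hull_ge0 andbT -[leRHS]/(0%:E) -(vol0 0).
by apply: box_hull_le; exact: sub0set.
Qed.

(** A cover by boxes is a cover by sets whose hull is at most the volume. Conversely each set of a
    cover is enclosed in a box at the cost of [e / 2^(k+1)], which sums to [e]. *)
Lemma lebn_mu_ext : @lebn R n = mu_ext box_hull.
Proof.
apply/funext => A; apply/eqP; rewrite eq_le; apply/andP; split; last first.
  apply: le_ereal_inf_tmp => _ [ab Aab <-].
  apply: (@le_trans _ _ (\sum_(0 <= k <oo) box_hull (box (ab.1 k) (ab.2 k)))%E).
    apply: ereal_inf_lbound; exists (fun k => box (ab.1 k) (ab.2 k)) => //.
    by split => // i; exact: sub_sigma_algebra.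
  apply: lee_nneseries => [k _ _|k _]; first exact: box_hull_ge0.
  exact: box_hull_le.
apply: le_ereal_inf_tmp => _ [F [_ AF] <-].
(* If some set of the cover has infinite hull, the sum is infinite and bounds everything; otherwise
   all hulls are finite and can be approximated. *)
have [[i ioo]|] := pselect (exists i, box_hull (F i) = +oo%E).
  rewrite (eseries_pinfty _ _ ioo) ?leey// => k _.
  by rewrite -ltNye (lt_le_trans _ (box_hull_ge0 _)).
rewrite -forallNE => Foo.
apply/lee_addgt0Pr => e e0.
rewrite (le_trans _ (epsilon_trick _ _ (ltW e0)))//; last first.
  by move=> k; exact: box_hull_ge0.
have /choice[ab Hab] : forall k, exists ab : V * V, F k `<=` box ab.1 ab.2 /\
    ((vol ab.1 ab.2)%:E <= box_hull (F k) + (e / (2 ^ k.+1)%:R)%:E)%E.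
  move=> k.
  have ek : 0 < e / (2 ^ k.+1)%:R by rewrite divr_gt0.
  have /(lb_ereal_inf_adherent ek) : box_hull (F k) \is a fin_num.
    by rewrite ge0_fin_numE ?box_hull_ge0// ltey; apply/eqP/Foo.
  by move=> [_ [ab Fab <-] /ltW H]; exists ab.
apply: (@le_trans _ _ (\sum_(0 <= k <oo) (vol (ab k).1 (ab k).2)%:E)%E).
  apply: ereal_inf_lbound; exists (fun k => (ab k).1, fun k => (ab k).2) => //=.
  by move=> x /AF[k _ /(Hab k).1]; exists k.
apply: lee_nneseries => [k _ _|k _]; first by rewrite lee_fin vol_ge0.
exact: (Hab k).2.
Qed.

Lemma lebn_set0 : @lebn R n set0 = 0%E.
Proof. by rewrite lebn_mu_ext mu_ext0 ?box_hull0//; exact: box_hull_ge0. Qed.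

Lemma lebn_ge0 A : (0 <= @lebn R n A)%E.
Proof. by rewrite lebn_mu_ext mu_ext_ge0//; exact: box_hull_ge0. Qed.

Lemma le_lebn : {homo @lebn R n : A B / A `<=` B >-> (A <= B)%E}.
Proof. by move=> A B AB; rewrite lebn_mu_ext; exact: (@le_mu_ext _ powV). Qed.

Lemma lebn_sigma_subadditive : sigma_subadditive (@lebn R n).
Proof.
move=> F; rewrite lebn_mu_ext.
exact: (@mu_ext_sigma_subadditive _ powV _ _ box_hull_ge0).
Qed.

HB.instance Definition _ := isOuterMeasure.Build R (@Rn R n) (@lebn R n)
  lebn_set0 lebn_ge0 le_lebn lebn_sigma_subadditive.

Lemma lebn_box_le (a b : V) : (lebn (box a b) <= (vol a b)%:E)%E.
Proof.
rewrite lebn_mu_ext; apply: (@le_trans _ _ (box_hull (box a b))); last first.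
  exact: box_hull_le.
apply: ereal_inf_lbound; exists (fun k => if k == 0%N then box a b else set0).
  split; first by move=> i; exact: sub_sigma_algebra.
  by move=> x ?; exists 0%N.
rewrite nneseries_recl//; last by move=> k _; exact: box_hull_ge0.
rewrite eseries0 ?adde0// => -[|k]//= _ _.
exact: box_hull0.
Qed.

(** The hyperplane [x_i = c] cuts the box in two. If it misses the box, the truncation at 0 in [vol]
    makes one piece vanish. *)
Lemma vol_cut (a b : V) (i : 'I_n) (c : R) :
  vol a (\row_j if j == i then Num.min (b 0 j) c else b 0 j) +
  vol (\row_j if j == i then Num.max (a 0 j) c else a 0 j) b = vol a b.
Proof.
rewrite /vol (bigD1 i)//= [X in _ + X = _](bigD1 i)//= [in RHS](bigD1 i)//= !mxE eqxx.
rewrite (eq_bigr (fun j => Num.max 0 (b 0 j - a 0 j))); last first.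
  by move=> j /negPf ji; rewrite mxE ji.
rewrite [X in _ + _ * X](eq_bigr (fun j => Num.max 0 (b 0 j - a 0 j))).
  rewrite -mulrDl; congr (_ * _).
  case: (leP (b 0 i) c) => ?; case: (leP (a 0 i) c) => ?;
  case: (leP 0 (b 0 i - a 0 i)) => ?; case: (leP 0 (c - a 0 i)) => ?;
  case: (leP 0 (b 0 i - c)) => ?; lra.
by move=> j /negPf ji; rewrite mxE ji.
Qed.

(** Cutting every box of a cover of [X] along the hyperplane gives covers of both parts of [X], with
    the same total volume by [vol_cut]. *)
Lemma caratheodory_halfspace (i : 'I_n) (c : R) :
  (@lebn R n).-caratheodory [set x : V | x 0 i <= c].
Proof.
apply: le_caratheodory_measurable => X.
apply: le_ereal_inf_tmp => _ [[a b] /= Xab <-].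
pose b' k : V := \row_j if j == i then Num.min (b k 0 j) c else b k 0 j.
pose a' k : V := \row_j if j == i then Num.max (a k 0 j) c else a k 0 j.
have -> : (\sum_(0 <= k <oo) (vol (a k) (b k))%:E)%E =
    (\sum_(0 <= k <oo) (vol (a k) (b' k))%:E +
     \sum_(0 <= k <oo) (vol (a' k) (b k))%:E)%E.
  rewrite -nneseriesD; last 2 first.
    by move=> k _ _; rewrite lee_fin vol_ge0.
    by move=> k _ _; rewrite lee_fin vol_ge0.
  by apply: eq_eseriesr => k _; rewrite -EFinD vol_cut.
apply: leeD; apply: ereal_inf_lbound.
  exists (a, b') => //= x [/Xab[k _ xk] /= xc]; exists k => // j.
  rewrite /b' mxE; case: eqP => [->|_]; last exact: xk.
  by rewrite le_min xc andbT; exact: xk.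
exists (a', b) => //= x [/Xab[k _ xk] /= /negP]; rewrite -ltNge => /ltW xc.
exists k => // j; rewrite /a' mxE; case: eqP => [->|_]; last exact: xk.
by rewrite ge_max xc andbT; exact: xk.
Qed.

(** The norm on row vectors is the maximum norm, so balls are open cubes, that is, finite
    intersections of half-spaces. *)
Lemma ball_coordE (x : V) e : 0 < e ->
  ball x e = \bigcap_(i in [set: 'I_n])
    ([set y : V | x 0 i - e < y 0 i] `&` [set y : V | y 0 i < x 0 i + e]).
Proof.
move=> e0; apply/seteqP; split => y /=.
  move=> [_ xy] i _; have := xy 0 i; rewrite /ball/= ltr_distlC.
  by move=> /andP[].
move=> H; split => // j i; rewrite ord1 /ball/= ltr_distlC.
by have [/= -> ->] := H i I.
Qed.

Lemma caratheodory_gt (i : 'I_n) (c : R) :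
  (@lebn R n).-caratheodory [set x : V | c < x 0 i].
Proof.
have -> : [set x : V | c < x 0 i] = ~` [set x | x 0 i <= c].
  by apply/seteqP; split => x /=; rewrite ltNge => /negP.
exact/caratheodory_measurable_setC/caratheodory_halfspace.
Qed.

Lemma caratheodory_lt (i : 'I_n) (c : R) :
  (@lebn R n).-caratheodory [set x : V | x 0 i < c].
Proof.
have -> : [set x : V | x 0 i < c] = \bigcup_k [set x | x 0 i <= c - k.+1%:R^-1].
  apply/seteqP; split => [x /= xc|x [k _ /=]]; last first.
    by move=> /le_lt_trans; apply; rewrite ltrBlDr ltrDl.
  have /ltr_add_invr[k xk] := xc.
  by exists k => //=; rewrite lerBrDr ltW.
by apply: caratheodory_measurable_bigcup => k; exact: caratheodory_halfspace.
Qed.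

Lemma caratheodory_ball (x : V) (e : R) : 0 < e ->
  (@lebn R n).-caratheodory (ball x e).
Proof.
move=> e0; rewrite ball_coordE//.
apply: (@fin_bigcap_measurable _ (caratheodory_type (@lebn R n))) => // i _.
by apply: caratheodory_measurable_setI;
  [exact: caratheodory_gt|exact: caratheodory_lt].
Qed.

(** Second countability with rational centres and radii [1/(k+1)]. A pair whose ball leaves [U]
    contributes the empty set, so that the union runs over a whole countable type. *)
Lemma open_bigcup_rat_ball (U : set V) : open U ->
  U = \bigcup_(qk : 'rV[rat]_n * nat)
      [set x | ball (map_mx ratr qk.1 : V) qk.2.+1%:R^-1 `<=` U /\
               ball (map_mx ratr qk.1 : V) qk.2.+1%:R^-1 x].
Proof.
move=> oU; apply/seteqP; split => [x Ux|x [[q k] _ /= [+ xq]]]; last exact.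
move: oU; rewrite openE => /(_ _ Ux)/nbhs_ballP[e /= e0 eU].
have /ltr_add_invr[k] : 0 < e / 2 by rewrite divr_gt0.
rewrite add0r => ke; pose d : R := k.+1%:R^-1.
have d0 : 0 < d by rewrite invr_gt0.
have /choice[q qx] : forall i, exists q : rat, ball (x 0 i) d (ratr q).
  move=> i; have /rat_in_itvoo[q /itvP qx] : x 0 i < x 0 i + d by rewrite ltrDl.
  exists q; rewrite /ball/= distrC ltr_distl qx andbT.
  by rewrite (@lt_trans _ _ (x 0 i)) ?qx// ltrBlDr ltrDl.
have xq : ball (map_mx ratr (\row_i q i) : V) d x.
  split=> // j i; rewrite !mxE ord1; exact/ball_sym/qx.
exists (\row_i q i, k) => //=; split=> // y yq; apply: eU.
rewrite (splitr e); apply: le_ball (ball_triangle (ball_sym xq) yq).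
by rewrite lerD// ltW.
Qed.

Lemma caratheodory_open (U : set V) : open U -> (@lebn R n).-caratheodory U.
Proof.
move=> /open_bigcup_rat_ball ->.
apply: (@countable_bigcupT_measurable _ (caratheodory_type (@lebn R n))) => //.
move=> [q k] /=; have [qU|qU] :=
    pselect (ball (map_mx ratr q : V) k.+1%:R^-1 `<=` U).
  rewrite [X in measurable X](_ : _ = ball (map_mx ratr q : V) k.+1%:R^-1).
    by apply: caratheodory_ball; rewrite invr_gt0.
  by apply/seteqP; split => x //= [].
by rewrite [X in measurable X](_ : _ = set0)//; apply/seteqP; split => x //= [].
Qed.

Lemma caratheodory_measurable_Rn (A : set (@Rn R n)) :
  measurable A -> (@lebn R n).-caratheodory A.
Proof.
apply: smallest_sub; last exact: caratheodory_open.
exact: (@sigma_algebra_measurable _ (caratheodory_type (@lebn R n))).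
Qed.

Lemma lebn_semi_sigma_additive : semi_sigma_additive (@lebn R n).
Proof.
move=> F mF tF mUF.
by apply: (@caratheodory_measure_sigma_additive _ _ (@lebn R n)) => // [i|];
  exact: caratheodory_measurable_Rn.
Qed.

HB.instance Definition _ := isMeasure.Build _ (@Rn R n) R (@lebn R n)
  lebn_set0 lebn_ge0 lebn_semi_sigma_additive.

(** Shifting the boxes of a cover preserves their volumes, which gives one inequality for every
    shift. *)
Lemma lebn_shift (v : V) (A : set V) :
  lebn ((fun x : V => x + v) @^-1` A) = lebn A.
Proof.
have le (w : V) (B : set V) : (lebn ((fun x : V => (x + w)%R) @^-1` B) <= lebn B)%E.
  apply: le_ereal_inf_tmp => _ [[a b] /= Bab <-]; apply: ereal_inf_lbound.
  exists (fun k => a k - w, fun k => b k - w) => /=.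
    move=> x /= /Bab[k _ xk]; exists k => // i; rewrite !mxE.
    by have := xk i; rewrite mxE lerBlDr lerBrDr.
  apply: eq_eseriesr => k _; congr EFin; apply: eq_bigr => i _; rewrite !mxE.
  by congr (Num.max _ _); ring.
apply/eqP; rewrite eq_le le /=.
(* The reverse inequality is the same one for the inverse shift, applied to the preimage. *)
have := le (- v) ((fun x : V => x + v) @^-1` A).
congr (_ <= _)%E; congr lebn; apply/seteqP.
by split => x /=; rewrite addrNK.
Qed.

Lemma continuous_measurable_Rn (f : V -> R) :
  continuous f -> measurable_fun [set: @Rn R n] (f : @Rn R n -> R).
Proof.
move=> /continuousP cf; apply: (measurability _ (RGenOpens.measurableE R)).
move=> _ [_ [a [b ->] <-]]; rewrite setTI; apply: sub_sigma_algebra.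
exact/cf/interval_open.
Qed.

Lemma measurable_shift (v : V) :
  measurable_fun [set: @Rn R n] (fun x : @Rn R n => (x + v : @Rn R n)).
Proof.
apply: (@measurability _ _ (@Rn R n) (@Rn R n) _ _ (@open V)); first by [].
move=> _ [U oU <-]; rewrite setTI; apply: sub_sigma_algebra.
have /continuousP : continuous (fun x : V => x + v).
  by move=> x; apply: (@continuousD _ _ _ id (cst v)); [exact: cvg_id|exact: cst_continuous].
exact.
Qed.

(** By [lebn_shift] the pushforward of [lebn] under the shift agrees with [lebn] on measurable sets;
    the rest is change of variables. *)
Lemma integral_shift (v : V) (f : V -> R) :
  measurable_fun [set: @Rn R n] (f : @Rn R n -> R) ->
  (@lebn R n).-integrable setT (fun x : @Rn R n => (f (x + v))%:E) ->
  (\int[lebn]_(x in [set: @Rn R n]) (f (x + v)%R)%:E = \int[lebn]_x (f x)%:E)%E.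
Proof.
move=> mf intf.
have mEf : measurable_fun [set: @Rn R n] (EFin \o (f : @Rn R n -> R)).
  exact/measurable_EFinP.
have := @integral_pushforward _ _ _ _ R _ (measurable_shift v) (@lebn R n)
  setT _ mEf intf measurableT.
rewrite preimage_setT => <-.
apply: eq_measure_integral => [|msh A mA _]; first exact: measurable_shift.
exact: (lebn_shift v A).
Qed.

End lebesgue_outer_measure.

(** * Lower bound for the measure of a cube *)

Section cube_volume.
Context {R : realType}.

(* Integrate out one coordinate at a time; no compactness is needed since the
   one-dimensional Lebesgue integral commutes with countable sums. *)
Lemma cover_vol_ge (s : R) n (t : R) (c : nat -> R) (a b : nat -> 'I_n -> R) :
  0 <= s -> 0 <= t -> (forall k, 0 <= c k) ->
  (forall x : 'I_n -> R, (forall i, 0 <= x i <= s) ->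
    (t%:E <= \sum_(0 <= k <oo) (c k * \prod_(i < n) \1_(`[a k i, b k i]) (x i))%:E)%E) ->
  ((t * s ^+ n)%:E <=
    \sum_(0 <= k <oo) (c k * \prod_(i < n) Num.max 0 (b k i - a k i))%:E)%E.
Proof.
move=> s0; elim: n t c a b => [|n IH] t c a b t0 c0 H.
  have := H (fun=> 0); rewrite mulr1 => /(_ _)/le_trans; apply; first by case.
  apply: lee_nneseries => k _; first by rewrite big_ord0 mulr1 lee_fin.
  by rewrite !big_ord0.
have indic_ge0 (A : set R) x : (0 : R) <= \1_A x by rewrite indicE ler0n.
have max_ge0 (x : R) : 0 <= Num.max 0 x by rewrite le_max lexx.
rewrite exprS mulrA.
apply: (@le_trans _ _ (\sum_(0 <= k <oo) ((c k * Num.max 0 (b k ord0 - a k ord0)) *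
    \prod_(i < n) Num.max 0 (b k (lift ord0 i) - a k (lift ord0 i)))%:E)%E);
    last first.
  apply: lee_nneseries => k _.
    by move=> _; rewrite lee_fin mulr_ge0 ?mulr_ge0 ?prodr_ge0.
  by rewrite big_ord_recl mulrA.
apply: IH => [||x hx]; first exact: mulr_ge0.
  by move=> k; rewrite mulr_ge0.
pose P k : R := \prod_(i < n) \1_(`[a k (lift ord0 i), b k (lift ord0 i)]) (x i).
have P0 k : 0 <= P k by rewrite /P prodr_ge0.
pose mu := @lebesgue_measure R.
have ms : measurable (`[0, s]%classic : set R) by [].
(* With the other coordinates [x] fixed, the hypothesis at the point [z] with first coordinate [y]
   is integrated over [y] in [[0, s]]. *)
have E : (\int[mu]_(y in `[0%R, s]%classic) (cst t%:E y) <=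
    \int[mu]_(y in `[0%R, s]%classic)
      \sum_(0 <= k <oo) ((c k * P k)%:E * (\1_(`[a k ord0, b k ord0]) y)%:E))%E.
  apply: ge0_le_integral => //.
  - apply: (@ge0_emeasurable_sum _ _ _ _ _ xpredT) => [k y _ _|k _].
      by rewrite lee_fin !mulr_ge0.
    apply/measurable_EFinP; apply: measurable_funM => //.
  - move=> y; rewrite /= in_itv/= => hy.
    pose z i := if unlift ord0 i is Some j then x j else y.
    apply: le_trans (H z _) _.
      by move=> i; rewrite /z; case: unliftP => [j _|_].
    apply: lee_nneseries => k _.
      by move=> _; rewrite lee_fin mulr_ge0 ?prodr_ge0.
    rewrite -EFinM lee_fin big_ord_recl {1}/z unlift_none.
    under eq_bigr => j _ do rewrite /z liftK.
    by rewrite -/(P k) mulrCA mulrC.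
move: E; rewrite integral_cst//= lebesgue_measure_itv/= lte_fin.
rewrite integral_nneseries//; last 2 first.
- by move=> k; apply/measurable_EFinP; apply: measurable_funM.
- by move=> k y _; rewrite lee_fin !mulr_ge0.
have -> : (t%:E * (if (0 < s)%R then s%:E - 0%:E else 0) = (t * s)%:E)%E.
  case: ltP => [_|s0']; first by rewrite sube0.
  by rewrite mule0 (_ : s = 0) ?mulr0//; apply/eqP; rewrite eq_le s0 s0'.
move=> /le_trans; apply; apply: lee_nneseries => k _.
  by move=> _; apply: integral_ge0 => y _; rewrite lee_fin !mulr_ge0.
have cP0 : 0 <= c k * P k by exact: mulr_ge0.
rewrite ge0_integralZl_EFin//=; last exact/measurable_EFinP.
rewrite integral_indic// -/(P k) mulrAC [leRHS]EFinM lee_wpmul2l ?lee_fin//.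
(* The indicator is integrated over [[0, s]] only; dropping this restriction leaves the full side
   length as an upper bound. *)
apply: (@le_trans _ _ (mu `[a k ord0, b k ord0]%classic)).
  by apply: le_measure; rewrite ?inE//; exact: measurableI.
rewrite /mu lebesgue_measure_itv/= lte_fin; case: ltP => ab.
  by rewrite -EFinB lee_fin le_max lexx orbT.
by rewrite lee_fin.
Qed.

(** This is [cover_vol_ge] with all weights 1: a point of the cube lies in some box of the cover,
    whose product of indicators already contributes 1. *)
Lemma lebn_cube_ge m (s : R) : 0 <= s ->
  ((s ^+ m.+1)%:E <= lebn (box 0 (const_mx s) : set 'rV[R]_m.+1))%E.
Proof.
move=> s0; apply: le_ereal_inf_tmp => _ [[a b] /= sab <-].
have := @cover_vol_ge s m.+1 1 (fun=> 1) (fun k i => a k 0 i) (fun k i => b k 0 i).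
rewrite mul1r => /(_ s0 ler01 (fun=> ler01)) H.
apply: le_trans (H _) _ => [x hx|]; last first.
  apply: lee_nneseries => k _; last by rewrite mul1r.
  by move=> _; rewrite lee_fin mul1r vol_ge0.
have [|k _ xk] := sab (\row_i x i).
  by move=> i; rewrite !mxE.
have pos j : (0 <= (1 * \prod_(i < m.+1) \1_(`[a j 0 i, b j 0 i]) (x i))%:E :> \bar R)%E.
  by rewrite lee_fin mul1r prodr_ge0// => i _; rewrite indicE ler0n.
rewrite (@nneseriesD1 _ _ k)//.
rewrite [X in (X + _)%E](_ : _ = 1%E).
  by rewrite leeDl// nneseries_ge0.
rewrite mul1r big1// => i _; rewrite indicE mem_set//= in_itv/=.
by have := xk i; rewrite mxE.
Qed.

End cube_volume.

(** * Lipschitz functions and Lambda_1 *)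

Section Lambda1_lipschitz.
Context {R : realType} {n : nat}.
Local Notation V := 'rV[R]_n.

(** The distance is the maximum norm; [norm_le_eucl] passes to the Euclidean length in the Zygmund
    seminorm. *)
Definition lip (L : R) (f : V -> R) := forall x y, `|f x - f y| <= L * `|x - y|.

Lemma coord_le_norm (x : V) i : `|x 0 i| <= `|x|.
Proof.
rewrite [leRHS]/Num.Def.normr/= mx_normrE.
by apply/bigmax_geP; right => /=; exists (0, i).
Qed.

Lemma norm_le_eucl (x : V) : `|x| <= eucl x.
Proof.
rewrite [leLHS]/Num.Def.normr/= mx_normrE; apply/bigmax_leP; split.
  exact: sqrtr_ge0.
move=> [j i] _ /=; rewrite ord1 -sqrtr_sqr; apply: ler_wsqrtr.
by rewrite (bigD1 i)//= lerDl sumr_ge0// => k _; rewrite sqr_ge0.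
Qed.

Lemma lip_continuous L f : lip L f -> continuous f.
Proof.
move=> fL x A /nbhs_ballP[e /= e0 eA].
have L1 : 0 < `|L| + 1 by rewrite ltr_wpDl.
apply/nbhs_ballP; exists (e / (`|L| + 1)); first by rewrite /= divr_gt0.
move=> y; rewrite -ball_normE/= ltr_pdivlMr// mulrC => xy; apply: eA.
rewrite /ball/=; apply: le_lt_trans xy.
by rewrite (le_trans (fL _ _))// ler_wpM2r// (le_trans (ler_norm _))// lerDl.
Qed.

Lemma sup_norm_le (M : R) (f : V -> R) :
  (forall x, `|f x| <= M) -> (sup_norm f <= M%:E)%E.
Proof. by move=> fM; apply: ge_ereal_sup => _ [x _ <-]; rewrite lee_fin. Qed.

(** A second difference is a sum of two first differences, each at most [L * eucl h]; hence the
    factor 2. *)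
Lemma lip_Lambda1_norm_le (M L : R) (f : V -> R) :
  0 <= L -> (forall x, `|f x| <= M) -> lip L f ->
  (Lambda1_norm f <= (M + 2 * L)%:E)%E.
Proof.
move=> L0 fM fL; rewrite /Lambda1_norm EFinD; apply: leeD; first exact: sup_norm_le.
apply: ge_ereal_sup => _ [[x h] /= /andP[h0 _] <-].
rewrite lee_fin ler_pdivrMr//.
have -> : f (x + h) - 2 * f x + f (x - h) = (f (x + h) - f x) + (f (x - h) - f x).
  by ring.
have bound (v : V) : `|v| <= eucl h -> `|f (x + v) - f x| <= L * eucl h.
  by move=> vh; rewrite (le_trans (fL _ _))// addrAC subrr add0r ler_wpM2l.
rewrite (le_trans (ler_normD _ _))// -mulrA mulrDl mul1r lerD// bound//.
  exact: norm_le_eucl.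
by rewrite normrN norm_le_eucl.
Qed.

Lemma lip_Lambda1 (M L : R) (f : V -> R) :
  0 <= L -> (forall x, `|f x| <= M) -> lip L f -> Lambda1 f.
Proof.
move=> L0 fM fL; split; first exact: lip_continuous fL.
split; first by rewrite (le_lt_trans (sup_norm_le fM))// ltry.
by rewrite (le_lt_trans (lip_Lambda1_norm_le L0 fM fL))// ltry.
Qed.

End Lambda1_lipschitz.

(** * Integration by parts *)

Section integration_by_parts.
Context {R : realType} {m : nat}.
Local Notation n := m.+1.
Local Notation V := 'rV[R]_n.
Local Notation Vm := (@Rn R n).

Lemma lebn_norm_le (r : R) : (lebn [set x : V | (`|x| <= r)%R] < +oo)%E.
Proof.
apply: (@le_lt_trans _ _ (lebn (box (const_mx (- r)) (const_mx r) : set V))).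
  apply: le_lebn => x /= xr i; rewrite !mxE -ler_norml.
  exact: le_trans (coord_le_norm _ _) xr.
exact: le_lt_trans (lebn_box_le _ _) (ltry _).
Qed.

Lemma measurable_norm_le (r : R) : measurable ([set x : V | `|x| <= r] : set Vm).
Proof.
have : measurable_fun [set: Vm] (fun x : Vm => `|x : V|).
  by apply: continuous_measurable_Rn => x; exact: norm_continuous.
move=> /(_ measurableT `]-oo, r]%classic); rewrite setTI.
have -> : (fun x : Vm => `|x : V|) @^-1` `]-oo, r]%classic = [set x : V | `|x| <= r].
  by apply/seteqP; split => x /=; rewrite in_itv.
by apply; exact: measurable_itv.
Qed.

Lemma integrable_bounded_support (F : Vm -> R) (M r : R) :
  measurable_fun [set: Vm] F -> (forall x, `|F x| <= M) ->
  (forall x : V, r < `|x| -> F x = 0) ->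
  (@lebn R n).-integrable setT (EFin \o F).
Proof.
move=> mF FM F0; pose B : set Vm := [set x : V | `|x| <= r].
have mB : measurable B := measurable_norm_le r.
have <- : F \_ B = F.
  apply/funext => x; rewrite patchE; case: ifPn => // /negP xB.
  by rewrite F0// ltNge; apply: contra_notN xB => ?; rewrite inE.
rewrite -restrict_EFin -integrable_mkcond//.
apply: measurable_bounded_integrable => //.
- exact: lebn_norm_le.
- exact: measurable_funTS.
- by exists M; split; [exact: num_real|move=> t Mt x _; exact: le_trans (FM x) (ltW Mt)].
Qed.

(** Steps [1/(k+1)] make the derivative the limit of a sequence, as measurability of limits and
    dominated convergence require. *)
Definition diff_quot (v : V) (F : V -> R) (k : nat) (x : V) : R :=
  k.+1%:R * (F (x + k.+1%:R^-1 *: v) - F x).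

Lemma diff_quot_cvg v F x : derivable F x v ->
  diff_quot v F k x @[k --> \oo] --> 'D_v F x.
Proof.
move=> dF.
have /((cvgr_dnbhsP _ _ _).1 dF) :
    (forall k, k.+1%:R^-1 != 0 :> R) /\ k.+1%:R^-1 @[k --> \oo] --> (0 : R).
  by split=> [k|]; [rewrite invr_neq0|exact: cvg_harmonic].
apply: cvg_trans; apply: near_eq_cvg; apply: nearW => k.
by rewrite /diff_quot/= invrK (addrC x).
Qed.

Section derivative_of_bounded_support.
Variables (i : 'I_n) (F : V -> R) (M C r : R).
Hypotheses (mF : measurable_fun [set: Vm] (F : Vm -> R)).
Hypotheses (FM : forall x, `|F x| <= M) (F0 : forall x, r < `|x| -> F x = 0).
Hypotheses (FC : forall x (t : R), `|F (x + t *: ev i) - F x| <= C * `|t|).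
Hypothesis dF : forall x, derivable F x (ev i).

Lemma diff_quot_le k x : `|diff_quot (ev i) F k x| <= C.
Proof.
rewrite /diff_quot normrM ger0_norm//.
rewrite -ler_pdivlMl// mulrC (le_trans (FC _ _))// ger0_norm//.
Qed.

Lemma norm_ev_le : `|ev i : V| <= 1.
Proof.
rewrite [leLHS]/Num.Def.normr/= mx_normrE; apply/bigmax_leP; split => // -[a b] _ /=.
by rewrite mxE; case: (_ && _); rewrite ?normr1 ?normr0.
Qed.

(** The step has norm at most 1, so enlarging the radius by 1 serves all [k] at once. *)
Lemma diff_quot_eq0 k x : r + 1 < `|x| -> diff_quot (ev i) F k x = 0.
Proof.
move=> rx; rewrite /diff_quot !F0 ?subrr ?mulr0//; first by lra.
have : `|k.+1%:R^-1 *: ev i : V| <= 1.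
  rewrite normrZ ger0_norm// -[leRHS]mulr1 ler_pM// ?norm_ev_le//.
  by rewrite invf_le1// ler1n.
have := ler_normB (x + k.+1%:R^-1 *: ev i) (k.+1%:R^-1 *: ev i).
by rewrite addrK; lra.
Qed.

Lemma measurable_diff_quot k :
  measurable_fun [set: Vm] (diff_quot (ev i) F k : Vm -> R).
Proof.
apply: measurable_funM => //; apply: measurable_funB => //.
exact: (measurableT_comp mF (measurable_shift _)).
Qed.

Lemma measurable_partial : measurable_fun [set: Vm] ('D_(ev i) F : Vm -> R).
Proof.
apply: (measurable_fun_cvg measurable_diff_quot) => x _.
exact: diff_quot_cvg.
Qed.

Lemma partial_le x : `|'D_(ev i) F x| <= C.
Proof.
have /cvg_norm/(@cvg_lim _) <- // := diff_quot_cvg (@dF x).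
apply: limr_le.
  by apply: is_cvg_norm; apply/cvg_ex; eexists; exact: diff_quot_cvg.
by apply: nearW => k; exact: diff_quot_le.
Qed.

Lemma partial_eq0 x : r + 1 < `|x| -> 'D_(ev i) F x = 0.
Proof.
move=> rx; have /(@cvg_lim _) <- // := diff_quot_cvg (@dF x).
under eq_fun do rewrite diff_quot_eq0//.
by rewrite lim_cst.
Qed.

(* Each difference quotient integrates to 0 by translation invariance. *)
Lemma integral_partial : (\int[lebn]_(x in [set: Vm]) ('D_(ev i) F x)%:E = 0)%E.
Proof.
have intF := integrable_bounded_support mF FM F0.
have intFs v : (@lebn R n).-integrable setT (fun x : Vm => (F (x + v))%:E).
  apply: (@integrable_bounded_support (fun x => F (x + v)) M (r + `|v|)).
  - exact: (measurableT_comp mF (measurable_shift _)).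
  - by move=> x; exact: FM.
  - move=> x rx; apply: F0; have := ler_normB (x + v) v.
    by rewrite addrK; lra.
have C0 : 0 <= C by apply: le_trans (partial_le 0).
pose B : set Vm := [set x : V | `|x| <= r + 1].
have mB : measurable B := measurable_norm_le (r + 1).
have mq k : measurable_fun [set: Vm] (EFin \o (diff_quot (ev i) F k : Vm -> R)).
  by apply/measurable_EFinP; exact: measurable_diff_quot.
have mD : measurable_fun [set: Vm] (EFin \o ('D_(ev i) F : Vm -> R)).
  by apply/measurable_EFinP; exact: measurable_partial.
have qD : {ae @lebn R n, forall x : Vm, [set: Vm] x ->
    (EFin \o (diff_quot (ev i) F k : Vm -> R)) x @[k --> \oo] -->
    (EFin \o ('D_(ev i) F : Vm -> R)) x}.
  apply: aeW => x _; apply: cvg_EFin; first exact: nearW.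
  exact: diff_quot_cvg.
(* The dominating function: all quotients are bounded by [C] and vanish outside the same ball. *)
have ig : (@lebn R n).-integrable setT (EFin \o (fun x : Vm => C * \1_B x)).
  apply: (@integrable_bounded_support _ C (r + 1)).
  + by apply: measurable_funM.
  + move=> x; rewrite normrM (ger0_norm C0) ler_piMr// indicE.
    by case: (_ \in _); rewrite ?normr1 ?normr0.
  + move=> x rx; rewrite indicE memNset ?mulr0// /B/=; apply/negP.
    by rewrite -ltNge.
have dom : {ae @lebn R n, forall (x : Vm) k, [set: Vm] x ->
    (`|(EFin \o (diff_quot (ev i) F k : Vm -> R)) x| <=
    (EFin \o (fun x : Vm => C * \1_B x)%R) x)%E}.
  apply: aeW => x k _; rewrite /= lee_fin indicE; case: (boolP (x \in B)) => xB.
    by rewrite mulr1 diff_quot_le.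
  rewrite diff_quot_eq0 ?normr0 ?mulr0// ltNge.
  by apply: contra xB => ?; rewrite inE.
have [_ _ /(@cvg_lim _) <- //] := dominated_convergence measurableT mq mD qD ig dom.
rewrite [X in limn X](_ : _ = cst 0%E) ?lim_cst//.
apply/funext => k /=; rewrite /diff_quot.
under eq_integral => x _ do rewrite EFinM EFinB.
rewrite integralZl//; last exact: integrableB.
rewrite integralB// (integral_shift mF (intFs _)) subee ?mule0//.
exact: integrable_fin_num.
Qed.

End derivative_of_bounded_support.
Lemma continuous_compact_support_bounded (f : V -> R) :
  continuous f -> compact (closure [set x | f x != 0]) ->
  exists K, forall x, `|f x| <= K.
Proof.
move=> cf cK.
have /compact_bounded[K [_ HK]] : compact [set f x | x in closure [set x | f x != 0]].
  by apply: continuous_compact => //; exact: continuous_subspaceT.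
exists (`|K| + 1) => x; have [->|fx] := eqVneq (f x) 0; first by rewrite normr0 addr_ge0.
apply: HK; first by rewrite (le_lt_trans (ler_norm _))// ltrDl.
by exists x => //; exact: subset_closure.
Qed.

(** Mean value theorem along the line through [x] in direction [ev i]; for negative [t] the
    endpoints are exchanged. *)
Lemma partial_lipschitz (f : V -> R) (i : 'I_n) K :
  (forall x, derivable f x (ev i)) -> (forall x, `|'D_(ev i) f x| <= K) ->
  forall x (t : R), `|f (x + t *: ev i) - f x| <= K * `|t|.
Proof.
move=> df fK.
have pos x (t : R) : 0 < t -> `|f (x + t *: ev i) - f x| <= K * t.
  move=> t0; pose g (s : R) := f (x + s *: ev i).
  have dg (s : R) : is_derive s 1 g ('D_(ev i) f (x + s *: ev i)).
    have E : (fun h : R => h^-1 *: ((g \o shift s) (h *: 1) - g s)) =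
        (fun h => h^-1 *: ((f \o shift (x + s *: ev i)) (h *: ev i) -
                           f (x + s *: ev i))).
      apply/funext => h; rewrite /g/=; congr (_ *: (f _ - _)).
      by rewrite -[h *: 1]/(h * 1) mulr1 scalerDl addrCA.
    by apply: DeriveDef; [rewrite /derivable E; exact: df|rewrite /derive E].
  have cg : {within `[0, t], continuous g}.
    apply: continuous_subspaceT => s; apply: differentiable_continuous.
    by apply/derivable1_diffP; case: (dg s).
  have [c _] := MVT t0 (fun s _ => dg s) cg.
  by rewrite /g scale0r addr0 subr0 => ->; rewrite normrM (gtr0_norm t0) ler_wpM2r// ltW.
move=> x t; have [t0|t0|->] := ltgtP t 0; last first.
- by rewrite scale0r addr0 subrr !normr0 mulr0.
- by rewrite (gtr0_norm t0) pos.
- rewrite (ltr0_norm t0) distrC; have := @pos (x + t *: ev i) (- t).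
  by rewrite oppr_gt0 scaleNr addrK; exact.
Qed.

Section test_function.
Variables (phi : V -> R) (i : 'I_n).
Hypothesis tphi : test_fun phi.

Lemma test_fun_derivable x : derivable phi x (ev i).
Proof. by apply: diff_derivable; exact: (tphi.1 [::]). Qed.

Lemma test_fun_continuous : continuous phi.
Proof. by move=> x; apply: differentiable_continuous; exact: (tphi.1 [::]). Qed.

Lemma test_fun_partial_continuous : continuous ('D_(ev i) phi).
Proof. by move=> x; apply: differentiable_continuous; exact: (tphi.1 [:: i]). Qed.

Lemma test_fun_bounded : exists K, forall x, `|phi x| <= K.
Proof.
by apply: continuous_compact_support_bounded tphi.2; exact: test_fun_continuous.
Qed.

Lemma test_fun_partial_bounded : exists K, forall x, `|'D_(ev i) phi x| <= K.
Proof.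
apply: continuous_compact_support_bounded.
  exact: test_fun_partial_continuous.
apply: subclosed_compact tphi.2 _; first exact: closed_closure.
(* The support of the derivative lies in that of [phi]: off the closed support, [phi] vanishes on a
   neighbourhood, and so does its derivative at the point. *)
rewrite closureE; apply: smallest_sub; first exact: closed_closure.
move=> x /= Dx; apply: contrapT => xphi; move/eqP: Dx; apply.
have : nbhs x (~` closure [set x | phi x != 0]).
  by apply: open_nbhs_nbhs; split => //; rewrite openC; exact: closed_closure.
move=> near0.
have <- : 'D_(ev i) (cst 0 : V -> R) x = 0 by exact: derive_cst.
apply: near_eq_derive => //.
apply: filterS near0 => y /= yphi; apply: contrapT => /eqP phiy; apply: yphi.
exact: subset_closure.
Qed.

End test_function.

Lemma Lp_bounded_support (p : R) (g : Vm -> R) (K s : R) : 0 < p ->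
  measurable_fun [set: Vm] g -> (forall x, `|g x| <= K) ->
  (forall x : V, s < `|x| -> g x = 0) -> Lp p g.
Proof.
move=> p0 mg gK g0; split => //.
have mp : measurable_fun [set: Vm] (fun x : Vm => `|g x| `^ p).
  apply: (measurableT_comp (measurable_powR p)).
  exact: measurableT_comp.
have : (@lebn R n).-integrable setT (EFin \o (fun x : Vm => `|g x| `^ p)).
  apply: (@integrable_bounded_support _ (K `^ p) s) => // [x|x sx].
    rewrite ger0_norm ?powR_ge0// ge0_ler_powR ?nnegrE//; first exact: ltW.
    exact: le_trans (normr_ge0 _) (gK x).
  by rewrite g0// normr0 powR0// gt_eqF.
move=> /integrableP[_]; under eq_integral => x _.
  rewrite /= ger0_norm ?powR_ge0//; over.
by [].
Qed.

(** The product [f * phi] is bounded, of bounded support and Lipschitz along [ev i], so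
    [integral_partial] applies to it; the product rule splits the vanishing integral into the two
    required terms. *)
Lemma weak_partial_lipschitz (f : V -> R) (M L r : R) (i : 'I_n) :
  continuous f ->
  (forall x, `|f x| <= M) -> (forall x, r < `|x| -> f x = 0) ->
  (forall x (t : R), `|f (x + t *: ev i) - f x| <= L * `|t|) ->
  (forall x, derivable f x (ev i)) -> weak_partial i f ('D_(ev i) f).
Proof.
move=> cf fM f0 fL df phi tphi.
have [K phiK] := test_fun_bounded tphi.
have [K' dphiK] := test_fun_partial_bounded i tphi.
have dphi x : derivable phi x (ev i) by exact: test_fun_derivable.
have phiL := partial_lipschitz dphi dphiK.
have mf : measurable_fun [set: Vm] (f : Vm -> R) := continuous_measurable_Rn cf.
have mphi : measurable_fun [set: Vm] (phi : Vm -> R).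
  by apply: continuous_measurable_Rn; exact: test_fun_continuous.
have mdphi : measurable_fun [set: Vm] ('D_(ev i) phi : Vm -> R).
  by apply: continuous_measurable_Rn; exact: test_fun_partial_continuous.
have mdf := measurable_partial mf df.
have dfL := partial_le fL df.
have df0 := partial_eq0 f0 df.
pose F : V -> R := f * phi.
have mF : measurable_fun [set: Vm] (F : Vm -> R) by exact: measurable_funM.
have FM x : `|F x| <= M * K by rewrite normrM ler_pM.
have FE x : F x = f x * phi x by [].
have F0 x : r < `|x| -> F x = 0 by move=> /f0 fx; rewrite FE fx mul0r.
have FC x (t : R) : `|F (x + t *: ev i) - F x| <= (M * K' + L * K) * `|t|.
  have -> : F (x + t *: ev i) - F x =
      f (x + t *: ev i) * (phi (x + t *: ev i) - phi x) +
      (f (x + t *: ev i) - f x) * phi x by rewrite !FE; ring.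
  rewrite (le_trans (ler_normD _ _))// !normrM mulrDl -mulrA (mulrAC L) lerD//.
    by rewrite ler_pM.
  by rewrite ler_pM.
have dF x : derivable F x (ev i) by exact: derivableM.
have DF x : 'D_(ev i) F x = f x * 'D_(ev i) phi x + 'D_(ev i) f x * phi x.
  by rewrite deriveM// [X in _ + X]mulrC.
have i1 : (@lebn R n).-integrable setT (EFin \o (fun x : Vm => f x * 'D_(ev i) phi x)).
  apply: (@integrable_bounded_support _ (M * K') r) => [|x|x rx].
  - exact: measurable_funM.
  - by rewrite normrM ler_pM.
  - by rewrite f0// mul0r.
have i2 : (@lebn R n).-integrable setT (EFin \o (fun x : Vm => 'D_(ev i) f x * phi x)).
  apply: (@integrable_bounded_support _ (L * K) (r + 1)) => [|x|x rx].
  - exact: measurable_funM.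
  - by rewrite normrM ler_pM.
  - by rewrite df0// mul0r.
have := integral_partial mF FM F0 FC dF.
under eq_integral => x _ do rewrite DF EFinD.
rewrite integralD//= => AB; have finB := integrable_fin_num measurableT i2.
by rewrite -[LHS](addeK _ finB) AB add0e.
Qed.

Lemma W1p_lipschitz (p : R) (f : V -> R) (M L r : R) : 0 < p ->
  (forall x, `|f x| <= M) -> lip L f -> (forall x, r < `|x| -> f x = 0) ->
  (forall x, differentiable f x) -> W1p p f.
Proof.
move=> p0 fM fL f0 df.
have cf : continuous f := lip_continuous fL.
have mf : measurable_fun [set: Vm] (f : Vm -> R) := continuous_measurable_Rn cf.
split; first exact: Lp_bounded_support mf fM f0.
move=> i; have dfi x : derivable f x (ev i) by exact: diff_derivable.
(* The absolute value of [L] makes the constant visibly nonnegative. *)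
have fLi x (t : R) : `|f (x + t *: ev i) - f x| <= `|L| * `|t|.
  rewrite (le_trans (fL _ _))// addrAC subrr add0r normrZ.
  apply: (@le_trans _ _ (`|L| * (`|t| * `|ev i : V|))).
    by rewrite ler_wpM2r ?mulr_ge0// ler_norm.
  by rewrite ler_wpM2l// ler_piMr// norm_ev_le.
exists ('D_(ev i) f); split; last exact: weak_partial_lipschitz cf fM f0 fLi dfi.
exact: (Lp_bounded_support p0 (measurable_partial mf dfi) (partial_le fLi dfi)
  (partial_eq0 f0 dfi)).
Qed.

End integration_by_parts.

(** * A slowly decaying function *)

Section slow_decay.
Context {R : realType} {m : nat}.
Local Notation n := m.+1.
Local Notation V := 'rV[R]_n.
Local Notation Vm := (@Rn R n).

Lemma sqr1_gt0 (t : R) : 0 < 1 + t ^+ 2.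
Proof. by rewrite ltr_wpDr// sqr_ge0. Qed.

Lemma ln_sqr1_ge0 (t : R) : 0 <= ln (1 + t ^+ 2).
Proof. by rewrite ln_ge0// lerDl sqr_ge0. Qed.

(** After exponentiation it suffices that [1 + x^2 <= (1 + y^2) (1 + d)^2] with [d = |x - y|], since
    [1 + d <= exp d]. For [x = y + d] or [x = y - d] the gap is [2 d (1 + y^2 - y)] or
    [2 d (1 + y^2 + y)], plus [d^2 y^2]. *)
Lemma ln_sqr1_lip (s t : R) : `|ln (1 + s ^+ 2) - ln (1 + t ^+ 2)| <= 2 * `|s - t|.
Proof.
have le (x y : R) : ln (1 + x ^+ 2) - ln (1 + y ^+ 2) <= 2 * `|x - y|.
  rewrite lerBlDl -[leRHS]expRK ler_ln ?posrE ?sqr1_gt0 ?expR_gt0//.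
  rewrite expRD lnK ?posrE ?sqr1_gt0// expRM_natl.
  apply: (@le_trans _ _ ((1 + y ^+ 2) * (1 + `|x - y|) ^+ 2)).
    have y1 : 0 <= 1 + y ^+ 2 - y /\ 0 <= 1 + y ^+ 2 + y by split; nra.
    have h2 : 0 <= y ^+ 2 * (x - y) ^+ 2 by rewrite mulr_ge0// sqr_ge0.
    have [xy|/ltW xy] := lerP y x; rewrite -subr_ge0 in xy.
      by have := mulr_ge0 xy y1.1; lra.
    by have := mulr_ge0 xy y1.2; lra.
  rewrite ler_pM2l ?sqr1_gt0// ler_pXn2r ?nnegrE ?addr_ge0 ?expR_ge0//.
  exact: expR_ge1Dx.
by rewrite ler_norml lerNl opprB le andbT distrC le.
Qed.

(** For [s <= t], factor out [exp (- s) <= 1] and use [1 - exp (- u) <= u] with [u = t - s]. *)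
Lemma expRN_lip (s t : R) : 0 <= s -> 0 <= t ->
  `|expR (- s) - expR (- t)| <= `|s - t|.
Proof.
wlog st : s t / s <= t.
  move=> H s0 t0; have /orP[st|ts] := le_total s t; first exact: H.
  by rewrite distrC [leRHS]distrC H.
move=> s0 t0; rewrite ger0_norm ?subr_ge0 ?ler_expR ?lerN2//.
rewrite distrC ger0_norm ?subr_ge0//.
have -> : - t = - s - (t - s) by ring.
rewrite expRD; have := expR_ge1Dx (- (t - s)).
have := expR_gt0 (- s); have : expR (- s) <= 1 by rewrite expR_le1; lra.
move: (expR _) (expR _) => A B; nra.
Qed.

Definition logsum (x : V) : R := \sum_(i < n) ln (1 + x 0 i ^+ 2).

Lemma logsum_ge0 x : 0 <= logsum x.
Proof. by apply: sumr_ge0 => i _; exact: ln_sqr1_ge0. Qed.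

Lemma logsum_lip : lip (2 * n%:R) logsum.
Proof.
move=> x y; rewrite /logsum -sumrB (le_trans (ler_norm_sum _ _ _))//.
apply: (@le_trans _ _ (\sum_(i < n) (2 * `|x - y|))).
  apply: ler_sum => i _; rewrite (le_trans (ln_sqr1_lip _ _))// ler_pM2l//.
  by have := coord_le_norm (x - y) i; rewrite !mxE.
by rewrite sumr_const card_ord -[leLHS]mulr_natr mulrAC.
Qed.

Lemma logsum_differentiable x : differentiable logsum x.
Proof.
have -> : logsum = \sum_(i < n) (fun x : V => ln (1 + x 0 i ^+ 2)).
  by apply/funext => y; rewrite fct_sumE.
apply: differentiable_sum => i.
apply: (@differentiable_comp _ _ _ _ (fun x : V => 1 + x 0 i ^+ 2) (@ln R)).
  rewrite (_ : (fun y : V => _) = cst 1 + (fun y : V => y 0 i) ^+ 2); last first.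
    by apply/funext.
  apply: differentiableD => //; apply: differentiableX.
  exact: differentiable_coord.
apply/derivable1_diffP.
by case: (is_derive1_ln (sqr1_gt0 (x 0 i))).
Qed.

(** The product of the [(1 + x_i^2)^(-a)], written as an exponential so that Lipschitz bounds and
    derivatives come from those of [logsum]. *)
Definition slow (a : R) (x : V) : R := expR (- (a * logsum x)).

Section slow_theory.
Variables (a : R) (a0 : 0 < a).
Local Notation h := (slow a).

Lemma slow_gt0 x : 0 < h x. Proof. exact: expR_gt0. Qed.

Lemma slow_le1 x : h x <= 1.
Proof. by rewrite expR_le1 oppr_le0 mulr_ge0 ?logsum_ge0// ltW. Qed.

Lemma slow_lip : lip (a * (2 * n%:R)) h.
Proof.
move=> x y; rewrite (le_trans (expRN_lip _ _)) ?mulr_ge0 ?logsum_ge0//; try exact: ltW.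
by rewrite -mulrBr normrM (gtr0_norm a0) -mulrA ler_pM2l// logsum_lip.
Qed.

Lemma slow_differentiable x : differentiable h x.
Proof.
apply: (@differentiable_comp _ _ _ _ (fun x : V => - (a * logsum x)) (@expR R)).
  apply: (@differentiableN _ _ _ (fun x : V => a * logsum x)).
  exact/(@differentiableZ _ _ _ logsum)/logsum_differentiable.
exact/derivable1_diffP/derivable_expR.
Qed.

(** The coordinate attaining the maximum norm suffices: if [|x_i|] exceeds the radius [A], then
    [1 + x_i^2 >= A], so this single logarithm is at least [- ln e / a]. *)
Lemma slow_le (e : R) (x : V) : 0 < e -> expR (- ln e / a) < `|x| -> h x <= e.
Proof.
move=> e0 rx; have xn0 : mx_norm x != 0.
  by rewrite gt_eqF// (lt_trans _ rx)// expR_gt0.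
have [[j i] /= xE] := mx_norm_neq0 xn0; rewrite ord1 in xE.
rewrite /slow -[leRHS]lnK ?posrE// ler_expR lerNl.
rewrite mulrC -ler_pdivrMr//.
apply: (@le_trans _ _ (ln (1 + x 0 i ^+ 2))); last first.
  by rewrite /logsum (bigD1 i)//= lerDl sumr_ge0// => k _; exact: ln_sqr1_ge0.
rewrite -[leLHS]expRK ler_ln ?posrE ?sqr1_gt0 ?expR_gt0//.
have {}rx : expR (- ln e / a) < `|x 0 i| by rewrite -xE.
have := real_normK (num_real (x 0 i)).
have := expR_gt0 (- ln e / a).
move: (expR _) rx => A; nra.
Qed.

End slow_theory.

(** Squaring the positive part removes the corner at [t = e]. *)
Definition cut (e t : R) : R := Num.max (t - e) 0 ^+ 2.

Lemma cut_derivable e t : derivable (cut e) t 1.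
Proof.
apply/cvg_ex; exists (2 * Num.max (t - e) 0).
apply/cvgrPdist_le => d d0; exists d => //= s /=.
rewrite sub0r normrN => /ltW sd s0; apply: le_trans sd.
rewrite -[s *: 1]/(s * 1) mulr1 -[_ *: _]/(_ * _) /cut.
set p := Num.max (t - e) 0; set D := _ ^+ 2 - _.
(* The error of the quotient is at most [|s|], because the increment differs from [2 * p * s] by at
   most [s^2] on either side of the corner. *)
have -> : 2 * p - s^-1 * D = s^-1 * (2 * p * s - D) by field.
rewrite normrM normfV ler_pdivrMl ?normr_gt0// -expr2 real_normK ?num_real//.
rewrite ler_norml /D /p.
by case: (leP (t - e) 0) => h1; case: (leP (s + t - e) 0) => h2; nra.
Qed.

Lemma cut_dist_le e t : 0 < e <= 1 -> 0 <= t <= 1 -> `|cut e t - t ^+ 2| <= 2 * e.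
Proof.
move=> /andP[e0 e1] /andP[t0 t1]; rewrite ler_norml /cut.
by case: (leP (t - e) 0) => te; nra.
Qed.

(** On [t >= 0] the difference [t^2 - cut e t] is [t^2] up to [e] and [2 e t - e^2] beyond, so its
    slope never exceeds [2 e]. *)
Lemma cut_dist_lip e s t : 0 < e -> 0 <= s -> 0 <= t ->
  `|(cut e s - s ^+ 2) - (cut e t - t ^+ 2)| <= 2 * e * `|s - t|.
Proof.
wlog st : s t / s <= t.
  move=> H e0 s0 t0; have /orP[st|ts] := le_total s t; first exact: H.
  by rewrite distrC (distrC s) H.
move=> e0 s0 t0; rewrite (distrC s) (ger0_norm (_ : 0 <= t - s)) ?subr_ge0//.
rewrite ler_norml /cut.
by case: (leP (s - e) 0) => h1; case: (leP (t - e) 0) => h2; nra.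
Qed.

Lemma sqr_lip (s t : R) : 0 <= s <= 1 -> 0 <= t <= 1 ->
  `|s ^+ 2 - t ^+ 2| <= 2 * `|s - t|.
Proof.
move=> /andP[s0 s1] /andP[t0 t1]; rewrite subr_sqr normrM mulrC ler_wpM2r//.
by rewrite ger0_norm ?addr_ge0//; lra.
Qed.

End slow_decay.

(** * Failure of integrability, tested on large cubes *)

Section non_integrability.
Context {R : realType} {m : nat}.
Local Notation n := m.+1.
Local Notation V := 'rV[R]_n.
Local Notation Vm := (@Rn R n).

Lemma measurable_box (a b : V) : measurable (box a b : set Vm).
Proof.
have -> : box a b = \bigcap_(i in [set: 'I_n])
    ((fun x : V => x 0 i) @^-1` `[a 0 i, b 0 i]%classic).
  by apply/seteqP; split => x /= H i; [move=> _|]; have := H i; rewrite /= in_itv/=; auto.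
apply: fin_bigcap_measurable => // i _; rewrite -[X in measurable X]setTI.
apply: (@continuous_measurable_Rn R m (fun x => x 0 i)) => //.
exact: coord_continuous.
Qed.

(** The integral over the cube of side [t] is at least [c * t^n], and [t^n >= t] because
    [t >= 1]. *)
Lemma integral_eq_infty (F : Vm -> R) :
  measurable_fun [set: Vm] F -> (forall x, 0 <= F x) ->
  (forall s : R, 0 <= s -> exists t c : R, [/\ 1 <= t, 0 <= c, s <= c * t &
     forall x : V, box 0 (const_mx t) x -> c <= F x]) ->
  (\int[lebn]_(x in [set: Vm]) (F x)%:E = +oo)%E.
Proof.
move=> mF F0 H; apply: eq_infty => s.
have [t [c [t1 c0 sct cF]]] := H `|s| (normr_ge0 s).
have t0 : 0 <= t by exact: le_trans ler01 t1.
pose B : set Vm := box 0 (const_mx t).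
have mB : measurable B by exact: measurable_box.
apply: (@le_trans _ _ (\int[lebn]_(x in B) (F x)%:E)%E); last first.
  apply: ge0_subset_integral => //; first exact/measurable_EFinP.
  by move=> x _; rewrite lee_fin.
apply: (@le_trans _ _ (\int[lebn]_(x in B) (cst c%:E x))%E); last first.
  apply: ge0_le_integral => //.
  by apply/measurable_EFinP; exact: measurable_funTS.
rewrite integral_cst//; apply: (@le_trans _ _ (c%:E * (t ^+ n)%:E)%E); last first.
  by apply: lee_wpmul2l; rewrite ?lee_fin// lebn_cube_ge.
rewrite -EFinM lee_fin (le_trans (ler_norm _))// (le_trans sct)// ler_wpM2l//.
by rewrite exprS ler_peMr// exprn_ege1.
Qed.

(** Since [exp s >= 1] and [2 <= exp 1], one has [1 + t^2 <= 2 exp (2 s) <= exp (1 + 2 s)]. *)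
Lemma ln_sqr1_expR_le (s t : R) : 0 <= s -> 0 <= t <= expR s ->
  ln (1 + t ^+ 2) <= 1 + 2 * s.
Proof.
move=> s0 /andP[t0 ts]; rewrite -[leRHS]expRK ler_ln ?posrE ?sqr1_gt0 ?expR_gt0//.
rewrite expRD expRM_natl.
have e1 : 1 + 1 <= expR (1 : R) := expR_ge1Dx 1.
have e2 : 1 <= expR s by rewrite -expR0 ler_expR.
move: (expR 1) (expR s) e1 e2 ts => A B; nra.
Qed.

Lemma slow_sqr_not_Lp (p : R) : 0 < p ->
  ~ Lp p (fun x : Vm => slow (8 * p * n%:R)^-1 x ^+ 2).
Proof.
move=> p0 [mg]; set a := (8 * p * n%:R)^-1.
have n0 : 0 < n%:R :> R by rewrite ltr0n.
have gE x : `|slow a x ^+ 2| `^ p = expR (- (logsum x / (4 * n%:R))).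
  rewrite ger0_norm ?sqr_ge0// /slow -expRM_natl -expRM; congr expR.
  by rewrite /a; field; rewrite !gt_eqF.
rewrite integral_eq_infty//.
  apply: (measurableT_comp (measurable_powR p)).
  exact: measurableT_comp.
(* On the cube of side [exp (2 s)] each logarithm is at most [1 + 4 s], so [logsum x / (4 n)] is at
   most [(1 + 4 s) / 4]. The product of side and lower bound is [exp (s - 1/4) >= s + 3/4]. *)
move=> s s0; exists (expR (2 * s)), (expR (- (1 + 4 * s) / 4)); split.
- by rewrite -expR0 ler_expR mulr_ge0.
- exact: expR_ge0.
- rewrite -expRD (le_trans _ (expR_ge1Dx _))//; lra.
- move=> x xB; rewrite gE ler_expR mulNr lerN2 ler_pdivrMr ?mulr_gt0//.
  rewrite [leRHS](_ : _ = n%:R * (1 + 4 * s)); last by field.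
  rewrite mulr_natl -[X in _ *+ X]card_ord -sumr_const.
  apply: ler_sum => i _.
  have : ln (1 + x 0 i ^+ 2) <= 1 + 2 * (2 * s).
    apply: ln_sqr1_expR_le; first by rewrite mulr_ge0.
    by have := xB i; rewrite !mxE.
  lra.
Qed.

Lemma Lp_bounded_below (p c : R) (f : Vm -> R) :
  0 < p -> 0 < c -> (forall x, c <= `|f x|) -> ~ Lp p f.
Proof.
move=> p0 c0 cf [mf]; rewrite integral_eq_infty//.
  apply: (measurableT_comp (measurable_powR p)).
  exact: measurableT_comp.
move=> s s0; exists (Num.max 1 (s / c `^ p)), (c `^ p).
have cp : 0 < c `^ p by exact: powR_gt0.
split; first by rewrite le_max lexx.
- exact: ltW.
- by rewrite -ler_pdivrMl// mulrC le_max lexx orbT.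
- by move=> x _; rewrite ge0_ler_powR ?nnegrE// ltW.
Qed.

(** A supremum over the empty set would be [-oo]; a unit vector shows that admissible steps
    exist. *)
Lemma zyg_seminorm_ge0 (f : V -> R) : (0 <= zyg_seminorm f)%E.
Proof.
have e1 : eucl (ev ord0 : V) = 1.
  rewrite /eucl (bigD1 ord0)//= big1 ?addr0 ?mxE ?eqxx ?expr1n ?sqrtr1// => i i0.
  by rewrite mxE (negPf i0) andbF expr0n.
apply: le_trans (ereal_sup_ubound _); last first.
  by exists (0, ev ord0) => //=; rewrite e1 ltr01 lexx.
by rewrite lee_fin e1 divr_ge0.
Qed.

End non_integrability.

(** * The two strict inclusions *)

Theorem mainTheorem14 (R : realType) (n : nat) (hn : (0 < n)%N) (p : R) (hp : 1 < p) :
  let S := [set f : 'rV[R]_n -> R | W1p p f /\ Lambda1 f] in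
  S `<` Lambda1_closure S /\ Lambda1_closure S `<` @Lambda1 R n.
Proof.
case: n hn => // m _ S.
have p0 : 0 < p by exact: lt_trans ltr01 hp.
have n0 : 0 < m.+1%:R :> R by rewrite ltr0n.
split; split.
- move=> f [Wf Lf]; split => // e e0; exists f; split => //.
  apply: le_lt_trans (_ : _ <= (0 + 2 * 0)%:E)%E _.
    apply: lip_Lambda1_norm_le => // [x|x y]; rewrite !subrr ?subr0 normr0 ?mul0r//.
  by rewrite mulr0 addr0 lte_fin.
- pose a : R := (8 * p * m.+1%:R)^-1.
  have a0 : 0 < a by rewrite invr_gt0 !mulr_gt0.
  pose K := a * (2 * m.+1%:R).
  have K0 : 0 < K by rewrite !mulr_gt0.
  pose g (x : 'rV[R]_m.+1) := slow a x ^+ 2.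
  have h01 (x : 'rV[R]_m.+1) : 0 <= slow a x <= 1.
    by rewrite slow_le1// andbT ltW// slow_gt0.
  have h0 (x : 'rV[R]_m.+1) : 0 <= slow a x by rewrite ltW// slow_gt0.
  have gL : lip (2 * K) g.
    move=> x y; rewrite (le_trans (sqr_lip (h01 x) (h01 y)))// -mulrA ler_pM2l//.
    exact: slow_lip.
  have g1 x : `|g x| <= 1.
    by rewrite ger0_norm ?sqr_ge0// exprn_ile1// slow_le1.
  have Lg : Lambda1 g by apply: lip_Lambda1 gL; rewrite ?mulr_ge0 ?ltW.
  (* If the closure were contained in [S], then [g] would be in [L^p]; it remains to approximate
     [g]. *)
  move=> /(_ g)[]; last by move=> [/(slow_sqr_not_Lp p0)].
  split => // e e0.
  (* The bounds [2 d] on the sup norm and [2 d K] on the Lipschitz constant of [f - g] give norm at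
     most [2 d (1 + 2 K) <= e / 2]. *)
  pose d := Num.min 1 (e / (4 * (1 + 2 * K))).
  have d0 : 0 < d.
    by rewrite lt_min ltr01 divr_gt0// mulr_gt0// addr_gt0// mulr_gt0.
  have d1 : d <= 1 by rewrite ge_min lexx.
  pose f (x : 'rV[R]_m.+1) := cut d (slow a x).
  have fgM x : `|f x - g x| <= 2 * d by rewrite cut_dist_le ?d0.
  have fgL : lip (2 * d * K) (fun x => f x - g x).
    move=> x y; rewrite (le_trans (cut_dist_lip d0 (h0 x) (h0 y)))// -[leRHS]mulrA ler_pM2l.
      exact: slow_lip.
    by rewrite mulr_gt0.
  have f3 x : `|f x| <= 3.
    by have := ler_normD (f x - g x) (g x); rewrite subrK; have := fgM x; have := g1 x; lra.
  have fL : lip (2 * d * K + 2 * K) f.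
    move=> x y; have := fgL x y; have := gL x y.
    have := ler_normD (f x - g x - (f y - g y)) (g x - g y).
    have -> : f x - g x - (f y - g y) + (g x - g y) = f x - f y by ring.
    by rewrite mulrDl; lra.
  exists f; split; last first.
    apply: le_lt_trans (lip_Lambda1_norm_le _ fgM fgL) _.
      by rewrite !mulr_ge0// ltW.
    rewrite lte_fin; have : d <= e / (4 * (1 + 2 * K)) by rewrite ge_min lexx orbT.
    rewrite ler_pdivlMr; last by rewrite mulr_gt0// addr_gt0// mulr_gt0.
    by nra.
  split; last by apply: lip_Lambda1 fL => //; rewrite addr_ge0// !mulr_ge0// ltW.
  (* Beyond this radius [slow a] is at most [d] by [slow_le], so the cut vanishes there. *)
  apply: (W1p_lipschitz p0 f3 fL (r := expR (- ln d / a))).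
    move=> x /(slow_le a0 d0) hd; rewrite /f /cut max_r ?expr0n// subr_le0//.
  move=> x; apply: (@differentiable_comp _ _ _ _ (slow a) (cut d)).
    exact: slow_differentiable.
  by apply/derivable1_diffP; exact: cut_derivable.
- by move=> f [].
- pose one (x : 'rV[R]_m.+1) : R := 1.
  have L1 : Lambda1 one.
    apply: (@lip_Lambda1 _ _ 1 0) => // [x|x y]; first by rewrite normr1.
    by rewrite subrr normr0 mul0r.
  (* If the constant 1 were in the closure, some [f] in [S] would be within 1/2 of it in sup norm,
     hence at least 1/2 in absolute value everywhere. *)
  move=> /(_ one L1)[_ /(_ 2^-1)[]//] f [[[Lpf _] _] fone].
  apply: (Lp_bounded_below p0 (_ : 0 < 2^-1)) Lpf => // x.
  have : ((`|f x - 1|)%:E < (2^-1)%:E)%E.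
    apply: le_lt_trans fone; apply: (@le_trans _ _ (sup_norm (fun x => f x - one x))).
      by apply: ereal_sup_ubound; exists x.
    by rewrite leeDl// zyg_seminorm_ge0.
  rewrite lte_fin => fx; have := ler_normD (f x) (1 - f x).
  rewrite addrCA subrr addr0 normr1 distrC; lra.
Qed.
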